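(* Let $a>0$ and $b,k\in\mathbb{R}$ be constants with $k<a\pi^2+\frac{b^2}{4a}$. For $x_0\in C^2([0,1])$ and $v\in C^1(\mathbb{R}_+\times[0,1])$, let $\Phi(x_0,v)\subseteq C^1(\mathbb{R}_+;\mathbb{R}^2)$ be the non-empty set of pairs $(d_0,d_1)$ for which the evolution equation $$\frac{\partial x}{\partial t}(t,z)=a\frac{\partial^2x}{\partial z^2}(t,z)+b\frac{\partial x}{\partial z}(t,z)+kx(t,z)+v(t,z)\quad\text{for }(t,z)\in(0,+\infty)\times(0,1),$$ with $x(t,0)=d_0(t)$, $x(t,1)=d_1(t)$ for $t\ge0$ and initial condition $x_0$ has a unique solution $x\in C^0(\mathbb{R}_+\times[0,1])\cap C^1((0,+\infty)\times[0,1])$ with $x[t]\in C^2([0,1])$ for all $t\ge0$ and $x(0,z)=x_0(z)$ for all $z\in[0,1]$. Then for every $x_0\in C^2([0,1])$, $v\in C^1(\mathbb{R}_+\times[0,1])$ and $(d_0,d_1)\in\Phi(x_0,v)$, this unique solution satisfies, for all $t\ge0$, $$\|x[t]\|_{1,w}\le\exp\left(-\left(a\pi^2-k+\frac{b^2}{4a}\right)t\right)\|x[0]\|_{1,w}+\frac{4a^2\pi}{4a^2\pi^2+b^2-4ak}\left(\max_{0\le s\le t}|d_0(s)|+\exp\left(\frac{b}{2a}\right)\max_{0\le s\le t}|d_1(s)|\right)$$ $$\qquad+\frac{4a}{4a^2\pi^2+b^2-4ak}\max_{0\le s\le t}\left(\max_{0\le z\le1}\left(|v(s,z)|\exp\left(\frac{bz}{2a}\right)\sin(\pi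 z)\right)\right),$$ where $\|x[t]\|_{1,w}:=\int_0^1\exp\left(\frac{bz}{2a}\right)\sin(\pi z)|x(t,z)|dz$.
   Context: $\mathbb{R}_+=[0,+\infty)$. For a function $x$ on $\mathbb{R}_+\times[0,1]$, $x[t]$ denotes the profile $z\mapsto x(t,z)$. *)

(* Defs.v *)
(* Stdlib real numbers with Coquelicot. *)
From Stdlib Require Import Reals Lra.
From Coquelicot Require Import Coquelicot.
Open Scope R_scope.

Definition nonneg_reals (t : R) : Prop := 0 <= t.
Definition pos_reals (t : R) : Prop := 0 < t.
Definition unit_interval (z : R) : Prop := 0 <= z <= 1.

(* Derivative relative to D: one-sided at an endpoint of an interval D, the
   ordinary derivative ([is_derive]) at an interior point. *)
Definition is_derive_within (D : R -> Prop) (f : R -> R) (x l : R) : Prop :=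
  filterdiff f (within D (locally x)) (fun h : R => scal h l).

(* The class C^n(D), for an interval D. *)
Fixpoint Cn_on (n : nat) (D : R -> Prop) (f : R -> R) : Prop :=
  match n with
  | O => continuous_on D f
  | S m => exists f' : R -> R,
      (forall x, D x -> is_derive_within D f x (f' x)) /\ Cn_on m D f'
  end.

(* The classes C^0(I x J) and C^1(I x J), for intervals I and J. *)
Definition C0_on2 (I J : R -> Prop) (f : R -> R -> R) : Prop :=
  continuous_on (fun p : R * R => I (fst p) /\ J (snd p))
    (fun p : R * R => f (fst p) (snd p)).

Definition C1_on2 (I J : R -> Prop) (f : R -> R -> R) : Prop :=
  C0_on2 I J f /\
  exists ft fz : R -> R -> R,
    (forall t z, I t -> J z ->
       is_derive_within I (fun s => f s z) t (ft t z) /\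
       is_derive_within J (fun y => f t y) z (fz t z)) /\
    C0_on2 I J ft /\ C0_on2 I J fz.

(* The derivatives in the equation are taken at interior points, where the
   regularity requirements make them exist; so the default values of [Derive]
   at points of non-differentiability play no role. *)
Definition is_solution (a b k : R) (x0 : R -> R) (v : R -> R -> R)
    (d0 d1 : R -> R) (x : R -> R -> R) : Prop :=
  C0_on2 nonneg_reals unit_interval x /\
  C1_on2 pos_reals unit_interval x /\
  (forall t, 0 <= t -> Cn_on 2 unit_interval (x t)) /\
  (forall t z, 0 < t -> 0 < z < 1 ->
     Derive (fun s => x s z) t
     = a * Derive_n (x t) 2 z + b * Derive (x t) z + k * x t z + v t z) /\
  (forall t, 0 <= t -> x t 0 = d0 t /\ x t 1 = d1 t) /\
  (forall z, 0 <= z <= 1 -> x 0 z = x0 z).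

(* (d0, d1) belongs to Phi(x0, v). Solutions are functions on [0,+oo) x [0,1],
   so uniqueness ignores the values outside that set. *)
Definition Phi (a b k : R) (x0 : R -> R) (v : R -> R -> R)
    (d0 d1 : R -> R) : Prop :=
  Cn_on 1 nonneg_reals d0 /\ Cn_on 1 nonneg_reals d1 /\
  (exists x, is_solution a b k x0 v d0 d1 x) /\
  (forall x y, is_solution a b k x0 v d0 d1 x ->
     is_solution a b k x0 v d0 d1 y ->
     forall t z, 0 <= t -> 0 <= z <= 1 -> x t z = y t z).

(* The maximum of f over D, as a supremum; see [max_overE]. *)
Definition max_over (D : R -> Prop) (f : R -> R) : R :=
  real (Lub_Rbar (fun y => exists s, D s /\ y = f s)).

Lemma max_overE (D : R -> Prop) (f : R -> R) (s : R) :
  D s -> (forall s', D s' -> f s' <= f s) -> max_over D f = f s.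
Proof.
intros Ds Hs; unfold max_over.
rewrite (is_lub_Rbar_unique _ (Finite (f s))); [reflexivity | split].
- intros y [s' [Ds' ->]]; exact (Hs s' Ds').
- intros u Hu; apply Hu; exists s; auto.
Qed.

Definition norm_1w (a b : R) (f : R -> R) : R :=
  RInt (fun z => exp (b * z / (2 * a)) * sin (PI * z) * Rabs (f z)) 0 1.

(* Main.v *)
Require Import Defs.
From Stdlib Require Import Reals Lra.
From Coquelicot Require Import Coquelicot.
Open Scope R_scope.

(** The weight w(z) = exp(bz/2a) sin(pi z) is a positive eigenfunction of the
    adjoint operator with Dirichlet conditions:
      a w'' - b w' + k w = - c w,   w(0) = w(1) = 0,   c = a pi^2 - k + b^2/4a.
    Testing the equation against w sign(x) and integrating by parts twice gives,
    by Kato's inequality sign(x) x_zz <= |x|_zz,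
      d/dt |x[t]|_{1,w}
        <= - c |x[t]|_{1,w} + a pi (|d0(t)| + exp(b/2a) |d1(t)|) + max (w |v|),
    because w'(0) = pi and w'(1) = - pi exp(b/2a) are all that remains at the
    boundary.  Gronwall's inequality then gives the estimate; the two gains are
    a pi / c and 1 / c.

    The absolute value is not differentiable, so all this is done with
    phi(x) = sqrt(x^2 + e^2) in place of |x|.  Convexity of this function replaces Kato's
    inequality ([smooth_kato_ineq]), and the only defect is that y phi'(y) differs
    from phi(y), by at most e; it adds a term of order e to the differential
    inequality ([smooth_dissipation]).  The integrated estimate
    ([smooth_energy_estimate]) passes to the limit e -> 0 ([energy_estimate]).

    The profile x[t] is C^2 for each t, but joint continuity of x_zz, on which
    the integrations rest, is not among the regularity requirements.  It follows
    from the equation, which expresses x_zz by x_t, x_z, x and v, all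
    continuous up to z = 0 and z = 1 ([solution_spatial_derivatives]). *)

(** * Suprema and differential inequalities *)

(** [max_over] takes the real part of a supremum in the extended reals, so it
    compares with the values of [f] only when that supremum is finite: hence one
    lemma for both bounds. *)
Lemma max_over_between (D : R -> Prop) (f : R -> R) (M s : R) :
  D s -> (forall s', D s' -> f s' <= M) ->
  f s <= max_over D f <= M.
Proof.
intros Ds HM; unfold max_over.
destruct (Lub_Rbar_correct (fun y => exists s, D s /\ y = f s)) as [Hub Hlub].
assert (Hs := Hub (f s) (ex_intro _ s (conj Ds eq_refl))).
assert (HM' : Rbar_le (Lub_Rbar (fun y => exists s, D s /\ y = f s)) M).
{ apply Hlub; intros y [s' [Ds' ->]]; exact (HM s' Ds'). }
destruct (Lub_Rbar _) as [l | |]; simpl in *; easy.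
Qed.

Lemma le_of_derive_nonpos (f : R -> R) (p q : R) :
  p <= q ->
  (forall s, p < s < q -> exists l, is_derive f s l /\ l <= 0) ->
  (forall s, p <= s <= q -> continuous f s) ->
  f q <= f p.
Proof.
intros Hpq Hd Hc.
destruct (MVT_gen f p q (fun s => Rmin 0 (Derive f s))) as [c [_ Hcd]].
(* The point given by the mean value theorem may be an endpoint, where nothing
   is known of [Derive f]: truncating at 0 gives the right sign there too. *)
- intros s; rewrite Rmin_left, Rmax_right by easy; intros Hs.
  destruct (Hd s Hs) as [l [Hl Hl0]].
  rewrite (is_derive_unique _ _ _ Hl), Rmin_right; easy.
- intros s; rewrite Rmin_left, Rmax_right by easy; intros Hs.
  apply continuity_pt_filterlim, Hc, Hs.
- assert (H := Rmin_l 0 (Derive f c)); nra.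
Qed.

(** The function exp(c s) (f(s) - N/c) is nonincreasing. *)
Lemma gronwall (f : R -> R) (c N T : R) :
  0 < c -> 0 <= N -> 0 <= T ->
  (forall s, 0 <= s <= T -> continuous f s) ->
  (forall s, 0 < s < T -> exists l, is_derive f s l /\ l <= - c * f s + N) ->
  f T <= exp (- c * T) * f 0 + N / c.
Proof.
intros Hc HN HT Cf Df.
assert (Dexp : forall s, is_derive (fun s => exp (c * s)) s (c * exp (c * s))).
{ intros s; auto_derive; [easy | ring]. }
assert (H : exp (c * T) * (f T - N / c) <= exp (c * 0) * (f 0 - N / c)).
{ apply (le_of_derive_nonpos (fun s => exp (c * s) * (f s - N / c))); [easy | |].
  - intros s Hs; destruct (Df s Hs) as [l [Dl Hl]].
    exists (exp (c * s) * (l - (- c * f s + N))); split.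
    + evar_last.
      * exact (is_derive_mult _ _ s _ _ (Dexp s)
          (is_derive_minus _ _ s _ _ Dl (is_derive_const (N / c) s)) Rmult_comm).
      * unfold minus, plus, opp, zero, mult; simpl; unfold mult; simpl; field; lra.
    + assert (H := exp_pos (c * s)); nra.
  - intros s Hs.
    apply (continuous_mult (K := R_AbsRing)).
    + exact (ex_derive_continuous _ _ (ex_intro _ _ (Dexp s))).
    + apply (continuous_minus (V := R_NormedModule)); [now apply Cf | apply continuous_const]. }
rewrite Rmult_0_r, exp_0, Rmult_1_l in H.
assert (He : exp (- c * T) * exp (c * T) = 1).
{ rewrite <- exp_plus; replace (- c * T + c * T) with 0 by ring; apply exp_0. }
assert (Hp := exp_pos (- c * T)).
apply (Rmult_le_compat_l _ _ _ (Rlt_le _ _ Hp)) in H.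
rewrite <- Rmult_assoc, He, Rmult_1_l in H.
assert (0 <= N / c) by (apply Rdiv_le_0_compat; lra).
nra.
Qed.

(** * Continuity, integration and differentiation *)

Lemma Lipschitz1_continuous (f : R -> R) (z : R) :
  (forall y, Rabs (f y - f z) <= Rabs (y - z)) -> continuous f z.
Proof.
intros Hf; apply filterlim_locally; intros eps; exists eps; intros y Hy.
exact (Rle_lt_trans _ _ _ (Hf y) Hy).
Qed.

Lemma continuous_ex_RInt_unit (f : R -> R) :
  (forall z, continuous f z) -> ex_RInt f 0 1.
Proof.
intros Hf; apply (@ex_RInt_continuous R_CompleteNormedModule); intros z _; apply Hf.
Qed.

Lemma continuous_is_RInt_unit (f : R -> R) :
  (forall z, continuous f z) -> is_RInt f 0 1 (RInt f 0 1).
Proof.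
intros Hf; apply (RInt_correct (V := R_CompleteNormedModule)).
now apply continuous_ex_RInt_unit.
Qed.

Ltac cont := repeat match goal with
  | |- continuous (fun z => @?f z + @?g z) _ =>
      apply (continuous_plus (V := R_NormedModule) f g)
  | |- continuous (fun z => @?f z - @?g z) _ =>
      apply (continuous_minus (V := R_NormedModule) f g)
  | |- continuous (fun z => @?f z * @?g z) _ =>
      apply (continuous_mult (K := R_AbsRing) f g)
  end; try apply continuous_const; auto.

Lemma continuity_2d_continuous_r (F : R -> R -> R) (s z : R) :
  continuity_2d_pt F s z -> continuous (F s) z.
Proof.
intros HF; apply continuity_2d_pt_filterlim in HF.
apply (filterlim_comp _ _ _ (fun u => (s, u)) (fun p => F (fst p) (snd p))
  (locally z) (locally (s, z)) (locally (F s z))); [| exact HF].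
intros P [e He]; exists e; intros u Hu.
apply He; split; [apply ball_center | exact Hu].
Qed.

Lemma continuity_2d_snd (f : R -> R) (s z : R) :
  continuous f z -> continuity_2d_pt (fun _ u => f u) s z.
Proof.
intros Hf; apply (continuity_1d_2d_pt_comp f (fun _ u => u)).
- now apply continuity_pt_filterlim.
- apply continuity_2d_pt_id2.
Qed.

(** This is what carries the differential inequality, valid for positive times,
    down to the initial time. *)
Lemma continuous_RInt_param (F : R -> R -> R) (s : R) :
  (forall s z, continuity_2d_pt F s z) ->
  continuous (fun u => RInt (F u) 0 1) s.
Proof.
intros HF.
assert (Cz : forall u z, continuous (F u) z).
{ intros u z; apply continuity_2d_continuous_r, HF. }
apply filterlim_locally; intros eps.
assert (Heps : 0 < eps / 2) by (assert (H := cond_pos eps); lra).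
destruct (uniform_continuity_2d_1d' F 0 1 s (fun z _ => HF s z)
  (mkposreal _ Heps)) as [d Hd]; simpl in Hd.
exists d; intros u Hu.
change (Rabs (u - s) < d) in Hu.
change (Rabs (RInt (F u) 0 1 - RInt (F s) 0 1) < eps).
assert (Hdiff : is_RInt (fun z => minus (F u z) (F s z)) 0 1
   (minus (RInt (F u) 0 1) (RInt (F s) 0 1))).
{ apply (is_RInt_minus (V := R_NormedModule)); now apply continuous_is_RInt_unit. }
apply Rle_lt_trans with (eps / 2); [| lra].
assert (Hle := fun H => norm_RInt_le_const (V := R_NormedModule)
  (fun z => minus (F u z) (F s z)) 0 1 _ (eps / 2) Rle_0_1 H Hdiff).
rewrite Rminus_0_r, Rmult_1_l in Hle; apply Hle.
intros z Hz; change (Rabs (F u z - F s z) <= eps / 2).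
assert (H := cond_pos d).
apply Rabs_lt_between in Hu.
apply Rlt_le, Hd; try lra.
rewrite Rminus_eq_0, Rabs_R0; lra.
Qed.

(** Cut the segment from the origin to (s, z) into N pieces, each shorter than a
    modulus of uniform continuity for the tolerance 1: [F] grows by at most 1 on
    each piece, and N does not depend on (s, z). *)
Lemma continuity_2d_bounded (F : R -> R -> R) (p q : R) :
  (forall s z, continuity_2d_pt F s z) ->
  exists M, forall s z, 0 <= s <= p -> 0 <= z <= q -> F s z <= M.
Proof.
intros HF.
destruct (uniform_continuity_2d F 0 p 0 q (fun s z _ _ => HF s z)
  (mkposreal 1 Rlt_0_1)) as [d Hd]; simpl in Hd.
destruct (INR_archimed d (Rabs p + Rabs q) (cond_pos d)) as [N HN].
exists (F 0 0 + INR N); intros s z Hs Hz.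
assert (HN0 : 0 < INR N).
{ assert (H := cond_pos d). assert (H1 := Rabs_pos p).
  assert (H2 := Rabs_pos q). nra. }
assert (Hi : forall i, (i <= N)%nat ->
  F (INR i * (s / INR N)) (INR i * (z / INR N)) <= F 0 0 + INR i).
{ intros i; induction i as [|i IH]; intros Hi.
  - simpl; rewrite !Rmult_0_l; lra.
  - specialize (IH (Nat.lt_le_incl _ _ Hi)).
    assert (HiN : INR i + 1 <= INR N) by (rewrite <- S_INR; apply le_INR, Hi).
    assert (Hi0 := pos_INR i).
    assert (box : forall u w j, 0 <= u <= w -> 0 <= j <= INR N ->
      0 <= j * (u / INR N) <= w).
    { intros u w j Hu Hj.
      replace (j * (u / INR N)) with (u * (j / INR N)) by (field; lra).
      assert (0 <= j / INR N <= 1).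
      { split; [apply Rdiv_le_0_compat | apply Rle_div_l]; lra. }
      nra. }
    assert (step : forall u w, 0 <= u <= w -> w <= Rabs p + Rabs q ->
      Rabs ((INR i + 1) * (u / INR N) - INR i * (u / INR N)) < d).
    { intros u w Hu Hw.
      replace (_ - _) with (u / INR N) by ring.
      rewrite Rabs_pos_eq by (apply Rdiv_le_0_compat; lra).
      apply Rlt_div_l; lra. }
    assert (Hp1 := Rle_abs p). assert (Hq1 := Rle_abs q).
    assert (Hp2 := Rabs_pos p). assert (Hq2 := Rabs_pos q).
    rewrite S_INR.
    assert (H := Hd (INR i * (s / INR N)) (INR i * (z / INR N))
      ((INR i + 1) * (s / INR N)) ((INR i + 1) * (z / INR N))).
    assert (H' : Rabs (F ((INR i + 1) * (s / INR N)) ((INR i + 1) * (z / INR N)) -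
       F (INR i * (s / INR N)) (INR i * (z / INR N))) < 1).
    { apply H; try (apply box; lra).
      - apply (step s p); lra.
      - apply (step z q); lra. }
    apply Rabs_lt_between in H'; lra. }
specialize (Hi N (Nat.le_refl N)).
replace (INR N * (s / INR N)) with s in Hi by (field; lra).
replace (INR N * (z / INR N)) with z in Hi by (field; lra).
exact Hi.
Qed.

Lemma is_derive_of_within (D : R -> Prop) (f : R -> R) (x l : R) :
  locally x D -> is_derive_within D f x l -> is_derive f x l.
Proof.
intros HD [Hlin Hdom]; split; [exact Hlin |].
intros y Hy; rewrite <- (is_filter_lim_locally_unique _ _ Hy).
intros eps.
assert (Hx : is_filter_lim (within D (locally x)) x) by (intros P HP; now apply filter_le_within).
assert (H := Hdom x Hx eps); unfold within in H.
generalize (filter_and _ _ HD H); apply filter_imp.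
intros u [Du Hu]; exact (Hu Du).
Qed.

(** Meant for retractions [p], [q] onto [I], [J]: a function that is continuous
    relative to a rectangle extends to one that is continuous at points of the
    plane, in particular across the sides of the rectangle. *)
Lemma C0_on2_comp (I J : R -> Prop) (f : R -> R -> R) (p q : R -> R) (s z : R) :
  C0_on2 I J f -> locally s (fun r => I (p r)) -> (forall u, J (q u)) ->
  continuous p s -> continuous q z ->
  continuity_2d_pt (fun r u => f (p r) (q u)) s z.
Proof.
intros Hf HI HJ Cp Cq; apply continuity_2d_pt_filterlim.
apply (filterlim_comp _ _ _ (fun w => (p (fst w), q (snd w)))
  (fun w => f (fst w) (snd w)) (locally (s, z))
  (within (fun w => I (fst w) /\ J (snd w)) (locally (p s, q z)))
  (locally (f (p s) (q z)))).
- intros P [e He].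
  destruct HI as [d1 Hd1].
  destruct (proj1 (filterlim_locally p (p s)) Cp e) as [d2 Hd2].
  destruct (proj1 (filterlim_locally q (q z)) Cq e) as [d3 Hd3].
  assert (Hd : 0 < Rmin d1 (Rmin d2 d3)) by (repeat apply Rmin_pos; apply cond_pos).
  exists (mkposreal _ Hd); intros [r u] [Hr Hu]; simpl in Hr, Hu.
  assert (M1 := Rmin_l d1 (Rmin d2 d3)). assert (M2 := Rmin_r d1 (Rmin d2 d3)).
  assert (M3 := Rmin_l d2 d3). assert (M4 := Rmin_r d2 d3).
  apply He.
  + split; simpl.
    * apply Hd2, ball_le with (2 := Hr); simpl; lra.
    * apply Hd3, ball_le with (2 := Hu); simpl; lra.
  + split; simpl; [| apply HJ].
    apply Hd1, ball_le with (2 := Hr); simpl; lra.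
- apply (Hf (p s, q z)); split; simpl; [exact (locally_singleton _ _ HI) | apply HJ].
Qed.

(** * A smooth absolute value *)

Definition smooth_abs (e y : R) : R := sqrt (y ^ 2 + e ^ 2).
Definition smooth_sign (e y : R) : R := y / smooth_abs e y.

Lemma smooth_abs_bounds (e y : R) : 0 < e ->
  0 < smooth_abs e y /\ Rabs y <= smooth_abs e y <= Rabs y + e.
Proof.
intros He; unfold smooth_abs.
assert (Hy := Rabs_pos y).
rewrite <- (pow2_abs y).
assert (Hp : 0 < Rabs y ^ 2 + e ^ 2) by nra.
repeat split.
- now apply sqrt_lt_R0.
- rewrite <- (sqrt_pow2 (Rabs y)) at 1 by easy.
  apply sqrt_le_1_alt; nra.
- rewrite <- (sqrt_pow2 (Rabs y + e)) by lra.
  apply sqrt_le_1_alt; nra.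
Qed.

Lemma smooth_abs_sqr (e y : R) : smooth_abs e y ^ 2 = y ^ 2 + e ^ 2.
Proof.
unfold smooth_abs; rewrite pow2_sqrt; [easy | nra].
Qed.

Lemma smooth_sign_bound (e y : R) : 0 < e -> Rabs (smooth_sign e y) <= 1.
Proof.
intros He; destruct (smooth_abs_bounds e y He) as [H0 [H1 _]].
unfold smooth_sign; rewrite Rabs_div by lra.
rewrite (Rabs_pos_eq (smooth_abs e y)) by lra.
apply Rle_div_l; lra.
Qed.

(** The difference equals - e^2 / sqrt(y^2 + e^2).  It measures how far the
    smooth absolute value is from being homogeneous of degree 1. *)
Lemma smooth_sign_mult (e y : R) : 0 < e ->
  Rabs (smooth_sign e y * y - smooth_abs e y) <= e.
Proof.
intros He; destruct (smooth_abs_bounds e y He) as [H0 [H1 H2]].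
assert (Hs := smooth_abs_sqr e y).
assert (Hee : e <= smooth_abs e y) by nra.
unfold smooth_sign.
replace (_ - _) with (- (e ^ 2 / smooth_abs e y)).
- rewrite Rabs_Ropp, Rabs_pos_eq by (apply Rdiv_le_0_compat; nra).
  apply Rle_div_l; nra.
- replace (e ^ 2) with (smooth_abs e y ^ 2 - y ^ 2) by lra. field; lra.
Qed.

Lemma is_derive_smooth_abs (e y : R) : 0 < e ->
  is_derive (smooth_abs e) y (smooth_sign e y).
Proof.
intros He; destruct (smooth_abs_bounds e y He) as [H0 _].
unfold smooth_sign, smooth_abs in *.
assert (0 < y ^ 2 + e ^ 2) by nra.
auto_derive; [simpl in *; lra |].
replace (y * (y * 1) + e * (e * 1)) with (y ^ 2 + e ^ 2) by ring.
field; lra.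
Qed.

(** The form of this second derivative shows that it is positive, which is the
    convexity used in [smooth_kato_ineq]. *)
Lemma is_derive_smooth_sign (e y : R) : 0 < e ->
  is_derive (smooth_sign e) y (e ^ 2 / smooth_abs e y ^ 3).
Proof.
intros He; destruct (smooth_abs_bounds e y He) as [H0 _].
evar_last.
- apply (is_derive_div (fun y => y) (smooth_abs e)).
  + apply is_derive_id.
  + now apply is_derive_smooth_abs.
  + lra.
- assert (Hs := smooth_abs_sqr e y). change one with 1.
  replace (e ^ 2) with (smooth_abs e y ^ 2 - y ^ 2) by lra.
  unfold smooth_sign; field; lra.
Qed.

Lemma continuous_smooth_abs (e y : R) : 0 < e -> continuous (smooth_abs e) y.
Proof.
intros He; exact (ex_derive_continuous _ _ (ex_intro _ _ (is_derive_smooth_abs e y He))).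
Qed.

Lemma continuous_smooth_sign (e y : R) : 0 < e -> continuous (smooth_sign e) y.
Proof.
intros He; exact (ex_derive_continuous _ _ (ex_intro _ _ (is_derive_smooth_sign e y He))).
Qed.

(** * The weight as an eigenfunction of the adjoint operator *)

Definition weight (a b z : R) : R := exp (b * z / (2 * a)) * sin (PI * z).
Definition weight' (a b z : R) : R :=
  exp (b * z / (2 * a)) * (b / (2 * a) * sin (PI * z) + PI * cos (PI * z)).
(** Minus the principal Dirichlet eigenvalue of y |-> a y'' + b y' + k y. *)
Definition decay_rate (a b k : R) : R := a * PI ^ 2 - k + b ^ 2 / (4 * a).

Lemma weight_ge_0 (a b z : R) : 0 <= z <= 1 -> 0 <= weight a b z.
Proof.
intros Hz; apply Rmult_le_pos; [apply Rlt_le, exp_pos |].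
assert (H := PI_RGT_0).
apply sin_ge_0; nra.
Qed.

Lemma is_derive_weight (a b z : R) : 0 < a ->
  is_derive (weight a b) z (weight' a b z).
Proof.
intros Ha; unfold weight, weight'; auto_derive; [easy |].
change (b * z * / (2 * a)) with (b * z / (2 * a)).
generalize (exp (b * z / (2 * a))) (sin (PI * z)) (cos (PI * z)); intros E S C.
field; lra.
Qed.

(** The adjoint eigenvalue equation a w'' - b w' = - (c + k) w, solved for w''. *)
Lemma is_derive_weight' (a b k z : R) : 0 < a ->
  is_derive (weight' a b) z
   ((b * weight' a b z - (decay_rate a b k + k) * weight a b z) / a).
Proof.
intros Ha; unfold weight, weight', decay_rate; auto_derive; [easy |].
change (b * z * / (2 * a)) with (b * z / (2 * a)).
generalize (exp (b * z / (2 * a))) (sin (PI * z)) (cos (PI * z)); intros E S C.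
field; lra.
Qed.

Lemma continuous_weight (a b z : R) : 0 < a -> continuous (weight a b) z.
Proof.
intros Ha; exact (ex_derive_continuous _ _ (ex_intro _ _ (is_derive_weight a b z Ha))).
Qed.

Lemma continuous_weight' (a b z : R) : 0 < a -> continuous (weight' a b) z.
Proof.
intros Ha; exact (ex_derive_continuous _ _ (ex_intro _ _ (is_derive_weight' a b 0 z Ha))).
Qed.

(** * Dissipation at a fixed time *)

(** With phi = [smooth_abs e], the flux
      h = a (w phi'(y) y' - w' phi(y)) + b w phi(y)
    satisfies, by the equation for w,
      h' = w phi'(y) (a y'' + b y') + (c + k) w phi(y) + a w phi''(y) y'^2.
    The last term is nonnegative, so the integral is at most h(1) - h(0), where
    only the terms with w' survive since w vanishes at 0 and 1.  The derivatives
    of [y] are prescribed on the open interval only: the mean value theorem does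
    not see the endpoints. *)
Lemma smooth_kato_ineq (a b k e : R) (y y1 y2 : R -> R) :
  0 < a -> 0 < e ->
  (forall z, continuous y z) -> (forall z, continuous y1 z) ->
  (forall z, continuous y2 z) ->
  (forall z, 0 < z < 1 -> is_derive y z (y1 z)) ->
  (forall z, 0 < z < 1 -> is_derive y1 z (y2 z)) ->
  RInt (fun z => weight a b z * smooth_sign e (y z) * (a * y2 z + b * y1 z)
     + (decay_rate a b k + k) * (weight a b z * smooth_abs e (y z))) 0 1
  <= a * PI * (smooth_abs e (y 0) + exp (b / (2 * a)) * smooth_abs e (y 1)).
Proof.
intros Ha He Cy Cy1 Cy2 Dy Dy1.
set (g := fun z => _).
set (h := fun z =>
  a * (weight a b z * smooth_sign e (y z) * y1 z - weight' a b z * smooth_abs e (y z))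
  + b * (weight a b z * smooth_abs e (y z))).
assert (Cabs : forall z, continuous (fun z => smooth_abs e (y z)) z).
{ intros z; apply (continuous_comp y); [apply Cy | now apply continuous_smooth_abs]. }
assert (Csign : forall z, continuous (fun z => smooth_sign e (y z)) z).
{ intros z; apply (continuous_comp y); [apply Cy | now apply continuous_smooth_sign]. }
assert (Cw := fun z => continuous_weight a b z Ha).
assert (Cw' := fun z => continuous_weight' a b z Ha).
assert (Cg : forall z, continuous g z).
{ intros z; unfold g; cont. }
assert (Ch : forall z, continuous h z).
{ intros z; unfold h; cont. }
assert (Dg : forall z, is_derive (RInt g 0) z (g z)).
{ intros z; apply (is_derive_RInt (V := R_NormedModule) g (RInt g 0) 0 z); [| apply Cg].
  apply filter_forall; intros u.
  apply (RInt_correct (V := R_CompleteNormedModule)).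
  apply (@ex_RInt_continuous R_CompleteNormedModule); intros; apply Cg. }
assert (Hmon := le_of_derive_nonpos (fun z => RInt g 0 z - h z) 0 1 Rle_0_1).
simpl in Hmon.
assert (Hfin : RInt g 0 1 - h 1 <= RInt g 0 0 - h 0).
{ apply Hmon.
  - intros z Hz.
    exists (- (a * weight a b z * (e ^ 2 / smooth_abs e (y z) ^ 3) * y1 z ^ 2)); split.
    + assert (Dabs := is_derive_comp _ _ _ _ _ (is_derive_smooth_abs e (y z) He) (Dy z Hz)).
      assert (Dsign := is_derive_comp _ _ _ _ _ (is_derive_smooth_sign e (y z) He) (Dy z Hz)).
      assert (Dw := is_derive_weight a b z Ha).
      assert (Dw' := is_derive_weight' a b k z Ha).
      assert (D1 := is_derive_mult _ _ z _ _ (is_derive_mult _ _ z _ _ Dw Dsign Rmult_comm)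
        (Dy1 z Hz) Rmult_comm).
      assert (D2 := is_derive_mult _ _ z _ _ Dw' Dabs Rmult_comm).
      assert (D3 := is_derive_mult _ _ z _ _ Dw Dabs Rmult_comm).
      assert (Dh := is_derive_plus _ _ z _ _
        (is_derive_scal _ z a _ (is_derive_minus _ _ z _ _ D1 D2)) (is_derive_scal _ z b _ D3)).
      evar_last; [exact (is_derive_minus _ _ z _ _ (Dg z) Dh) |].
      unfold g, minus, plus, opp, scal, mult; simpl; unfold mult; simpl.
      field; split; [ | lra].
      apply Rgt_not_eq, smooth_abs_bounds, He.
    + assert (0 <= weight a b z) by (apply weight_ge_0; lra).
      assert (0 < smooth_abs e (y z)) by (apply smooth_abs_bounds, He).
      assert (0 <= a * weight a b z * (e ^ 2 / smooth_abs e (y z) ^ 3) * y1 z ^ 2); [| lra].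
      assert (0 <= e ^ 2 / smooth_abs e (y z) ^ 3)
        by (apply Rdiv_le_0_compat; [nra | now apply pow_lt]).
      apply Rmult_le_pos; [| apply pow2_ge_0].
      apply Rmult_le_pos; [apply Rmult_le_pos; lra | easy].
  - intros z _; apply (continuous_minus (V := R_NormedModule)); [| apply Ch].
    exact (ex_derive_continuous _ _ (ex_intro _ _ (Dg z))). }
rewrite RInt_point in Hfin; change zero with 0 in Hfin.
apply Rle_trans with (h 1 - h 0); [lra |].
unfold h, weight, weight'.
rewrite !Rmult_0_r, !Rmult_1_r, sin_0, sin_PI, cos_0, cos_PI.
replace (0 / (2 * a)) with 0 by (field; lra); rewrite exp_0; lra.
Qed.

(** For [y] a profile of the solution, the left-hand side is the time derivative
    of the integral of w phi(y) that appears on the right. *)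
Lemma smooth_dissipation (a b k e V : R) (y y1 y2 u : R -> R) :
  0 < a -> 0 < e ->
  (forall z, continuous y z) -> (forall z, continuous y1 z) ->
  (forall z, continuous y2 z) -> (forall z, continuous u z) ->
  (forall z, 0 < z < 1 -> is_derive y z (y1 z)) ->
  (forall z, 0 < z < 1 -> is_derive y1 z (y2 z)) ->
  (forall z, 0 <= z <= 1 -> weight a b z * Rabs (u z) <= V) ->
  RInt (fun z => weight a b z * (smooth_sign e (y z) *
     (a * y2 z + b * y1 z + k * y z + u z))) 0 1
  <= - decay_rate a b k * RInt (fun z => weight a b z * smooth_abs e (y z)) 0 1
     + a * PI * (smooth_abs e (y 0) + exp (b / (2 * a)) * smooth_abs e (y 1))
     + V + e * (Rabs k * RInt (weight a b) 0 1).
Proof.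
intros Ha He Cy Cy1 Cy2 Cu Dy Dy1 Hu.
assert (Hk := smooth_kato_ineq a b k e y y1 y2 Ha He Cy Cy1 Cy2 Dy Dy1).
assert (Cabs : forall z, continuous (fun z => smooth_abs e (y z)) z).
{ intros z; apply (continuous_comp y); [apply Cy | now apply continuous_smooth_abs]. }
assert (Csign : forall z, continuous (fun z => smooth_sign e (y z)) z).
{ intros z; apply (continuous_comp y); [apply Cy | now apply continuous_smooth_sign]. }
assert (Cw := fun z => continuous_weight a b z Ha).
set (g := fun z => _) in Hk.
assert (Cg : forall z, continuous g z).
{ intros z; unfold g; cont. }
set (f := fun z => weight a b z * smooth_abs e (y z)).
assert (Cf : forall z, continuous f z).
{ intros z; unfold f; cont. }
assert (Ig := continuous_is_RInt_unit g Cg).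
assert (If := continuous_is_RInt_unit f Cf).
assert (Iw := continuous_is_RInt_unit _ Cw).
assert (IV := is_RInt_const (V := R_NormedModule) 0 1 V).
assert (I := is_RInt_plus (V := R_NormedModule) _ _ _ _ _ _
  (is_RInt_plus (V := R_NormedModule) _ _ _ _ _ _
    (is_RInt_plus (V := R_NormedModule) _ _ _ _ _ _ Ig
      (is_RInt_scal (V := R_NormedModule) _ _ _ (- decay_rate a b k) _ If)) IV)
  (is_RInt_scal (V := R_NormedModule) _ _ _ (e * Rabs k) _ Iw)).
apply Rle_trans with (RInt g 0 1 + - decay_rate a b k * RInt f 0 1 + (1 - 0) * V
   + e * Rabs k * RInt (weight a b) 0 1); [| lra].
refine (is_RInt_le _ _ 0 1 _ _ Rle_0_1 (continuous_is_RInt_unit _ _) I _).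
- intros z; cont.
- intros z Hz.
  change (weight a b z * (smooth_sign e (y z) * (a * y2 z + b * y1 z + k * y z + u z))
   <= g z + - decay_rate a b k * f z + V + e * Rabs k * weight a b z).
  unfold g, f.
  assert (Hw : 0 <= weight a b z) by (apply weight_ge_0; lra).
  assert (Hs := smooth_sign_bound e (y z) He).
  assert (Hm := smooth_sign_mult e (y z) He).
  assert (H1 : k * (smooth_sign e (y z) * y z - smooth_abs e (y z)) <= e * Rabs k).
  { apply Rle_trans with (1 := Rle_abs _). rewrite Rabs_mult.
    assert (H := Rabs_pos k); nra. }
  assert (H2 : smooth_sign e (y z) * u z <= Rabs (u z)).
  { apply Rle_trans with (1 := Rle_abs _). rewrite Rabs_mult.
    assert (H := Rabs_pos (u z)); nra. }
  assert (H3 : weight a b z * Rabs (u z) <= V) by (apply Hu; lra).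
  apply (Rmult_le_compat_l _ _ _ Hw) in H1.
  apply (Rmult_le_compat_l _ _ _ Hw) in H2.
  lra.
Qed.

(** * The weighted L1 estimate *)

(** [X1] and [X2] stand for the first two space derivatives, and [U] for the
    source.  They are functions on the whole plane, so that differentiation under
    the integral sign over [0,1] has continuity at both ends of the interval. *)
Lemma smooth_energy_estimate (a b k e T D0 D1 V : R) (X X1 X2 U : R -> R -> R) :
  0 < a -> 0 < decay_rate a b k -> 0 < e -> 0 <= T ->
  (forall s z, continuity_2d_pt X s z) -> (forall s z, continuity_2d_pt U s z) ->
  (forall s z, 0 < s -> continuity_2d_pt X1 s z) ->
  (forall s z, 0 < s -> continuity_2d_pt X2 s z) ->
  (forall s z, 0 < s ->
     is_derive (fun r => X r z) s (a * X2 s z + b * X1 s z + k * X s z + U s z)) ->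
  (forall s z, 0 < s -> 0 < z < 1 -> is_derive (X s) z (X1 s z)) ->
  (forall s z, 0 < s -> 0 < z < 1 -> is_derive (X1 s) z (X2 s z)) ->
  (forall s, 0 <= s <= T -> Rabs (X s 0) <= D0) ->
  (forall s, 0 <= s <= T -> Rabs (X s 1) <= D1) ->
  (forall s z, 0 <= s <= T -> 0 <= z <= 1 -> weight a b z * Rabs (U s z) <= V) ->
  RInt (fun z => weight a b z * smooth_abs e (X T z)) 0 1
  <= exp (- decay_rate a b k * T)
       * RInt (fun z => weight a b z * smooth_abs e (X 0 z)) 0 1
     + (a * PI * ((D0 + e) + exp (b / (2 * a)) * (D1 + e)) + V
        + e * (Rabs k * RInt (weight a b) 0 1)) / decay_rate a b k.
Proof.
intros Ha Hs He HT CX CU CX1 CX2 DX DX1 DX2 HD0 HD1 HV.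
assert (H0T : 0 <= 0 <= T) by lra.
assert (Cw : forall s z, continuity_2d_pt (fun _ z => weight a b z) s z).
{ intros s z; now apply continuity_2d_snd, continuous_weight. }
assert (CF : forall s z,
  continuity_2d_pt (fun s z => weight a b z * smooth_abs e (X s z)) s z).
{ intros s z; apply continuity_2d_pt_mult; [apply Cw |].
  apply continuity_1d_2d_pt_comp; [| apply CX].
  now apply continuity_pt_filterlim, continuous_smooth_abs. }
assert (CS : forall s z, continuity_2d_pt (fun s z => smooth_sign e (X s z)) s z).
{ intros s z; apply continuity_1d_2d_pt_comp; [| apply CX].
  now apply continuity_pt_filterlim, continuous_smooth_sign. }
assert (DF : forall s z, 0 < s ->
  is_derive (fun r => weight a b z * smooth_abs e (X r z)) s
   (weight a b z * (smooth_sign e (X s z) *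
      (a * X2 s z + b * X1 s z + k * X s z + U s z)))).
{ intros s z Hs0. evar_last.
  - apply is_derive_scal.
    exact (is_derive_comp _ _ _ _ _ (is_derive_smooth_abs e (X s z) He) (DX s z Hs0)).
  - unfold scal; simpl; unfold mult; simpl; ring. }
apply (gronwall (fun s => RInt (fun z => weight a b z * smooth_abs e (X s z)) 0 1));
  try easy.
- assert (0 <= D0) by (apply Rle_trans with (2 := HD0 0 H0T), Rabs_pos).
  assert (0 <= D1) by (apply Rle_trans with (2 := HD1 0 H0T), Rabs_pos).
  assert (0 <= V).
  { apply Rle_trans with (2 := HV 0 0 H0T (conj (Rle_refl 0) Rle_0_1)).
    apply Rmult_le_pos; [apply weight_ge_0; lra | apply Rabs_pos]. }
  assert (0 <= RInt (weight a b) 0 1).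
  { apply RInt_ge_0; [lra | | intros z Hz; apply weight_ge_0; lra].
    apply continuous_ex_RInt_unit; intros z; now apply continuous_weight. }
  assert (0 <= a * PI) by (assert (H3 := PI_RGT_0); nra).
  assert (0 <= exp (b / (2 * a)) * (D1 + e)).
  { apply Rmult_le_pos; [apply Rlt_le, exp_pos | lra]. }
  assert (0 <= Rabs k * RInt (weight a b) 0 1).
  { apply Rmult_le_pos; [apply Rabs_pos | easy]. }
  assert (0 <= e * (Rabs k * RInt (weight a b) 0 1)) by (apply Rmult_le_pos; lra).
  assert (0 <= a * PI * (D0 + e + exp (b / (2 * a)) * (D1 + e)))
    by (apply Rmult_le_pos; lra).
  lra.
- intros s _. now apply continuous_RInt_param.
- intros s Hs0.
  eexists; split.
  + apply (is_derive_RInt_param (fun s z => weight a b z * smooth_abs e (X s z)) 0 1 s).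
    * exists (mkposreal s (proj1 Hs0)); intros r Hr z _.
      assert (0 < r).
      { change (Rabs (r - s) < s) in Hr; apply Rabs_lt_between in Hr; lra. }
      eexists; now apply DF.
    * intros z _.
      apply (continuity_2d_pt_ext_loc (fun s z => weight a b z * (smooth_sign e (X s z) *
        (a * X2 s z + b * X1 s z + k * X s z + U s z)))).
      -- exists (mkposreal s (proj1 Hs0)); intros r y Hr _; symmetry.
         apply is_derive_unique, DF.
         simpl in Hr; apply Rabs_lt_between in Hr; lra.
      -- assert (H := proj1 Hs0).
         repeat first [apply Cw | apply CS | apply CX | apply CU | now apply CX1
           | now apply CX2 | apply continuity_2d_pt_const
           | apply (continuity_2d_pt_plus (fun s z => _) (fun s z => _))
           | apply (continuity_2d_pt_mult (fun s z => _) (fun s z => _)) ].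
    * apply filter_forall; intros r; apply continuous_ex_RInt_unit; intros z.
      apply (continuity_2d_continuous_r (fun s z => weight a b z * smooth_abs e (X s z))), CF.
  + rewrite (RInt_ext _ (fun z => weight a b z * (smooth_sign e (X s z) *
        (a * X2 s z + b * X1 s z + k * X s z + U s z)))).
    2: { intros z _; now apply is_derive_unique, DF. }
    assert (HsT : 0 <= s <= T) by lra.
    eapply Rle_trans.
    * apply (smooth_dissipation a b k e V (X s) (X1 s) (X2 s) (U s)); try easy;
        try (intros z; apply continuity_2d_continuous_r); auto; try apply Hs0.
      -- apply CX1, Hs0.
      -- apply CX2, Hs0.
      -- intros z; now apply DX1.
      -- intros z; now apply DX2.
    * assert (H3 := PI_RGT_0).
      assert (H0 := proj2 (proj2 (smooth_abs_bounds e (X s 0) He))).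
      assert (H1 := proj2 (proj2 (smooth_abs_bounds e (X s 1) He))).
      assert (H0' := HD0 s HsT). assert (H1' := HD1 s HsT).
      assert (exp (b / (2 * a)) * smooth_abs e (X s 1) <= exp (b / (2 * a)) * (D1 + e)).
      { apply Rmult_le_compat_l; [apply Rlt_le, exp_pos | lra]. }
      assert (a * PI * (smooth_abs e (X s 0) + exp (b / (2 * a)) * smooth_abs e (X s 1)) <=
        a * PI * (D0 + e + exp (b / (2 * a)) * (D1 + e))).
      { apply Rmult_le_compat_l; [nra | lra]. }
      lra.
Qed.

(** The limit e -> 0 of the previous estimate: phi lies between the absolute value
    and the absolute value plus e, so each side moves by a multiple of e. *)
Lemma energy_estimate (a b k T D0 D1 V : R) (X X1 X2 U : R -> R -> R) :
  0 < a -> 0 < decay_rate a b k -> 0 <= T ->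
  (forall s z, continuity_2d_pt X s z) -> (forall s z, continuity_2d_pt U s z) ->
  (forall s z, 0 < s -> continuity_2d_pt X1 s z) ->
  (forall s z, 0 < s -> continuity_2d_pt X2 s z) ->
  (forall s z, 0 < s ->
     is_derive (fun r => X r z) s (a * X2 s z + b * X1 s z + k * X s z + U s z)) ->
  (forall s z, 0 < s -> 0 < z < 1 -> is_derive (X s) z (X1 s z)) ->
  (forall s z, 0 < s -> 0 < z < 1 -> is_derive (X1 s) z (X2 s z)) ->
  (forall s, 0 <= s <= T -> Rabs (X s 0) <= D0) ->
  (forall s, 0 <= s <= T -> Rabs (X s 1) <= D1) ->
  (forall s z, 0 <= s <= T -> 0 <= z <= 1 -> weight a b z * Rabs (U s z) <= V) ->
  norm_1w a b (X T)
  <= exp (- decay_rate a b k * T) * norm_1w a b (X 0)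
     + (a * PI * (D0 + exp (b / (2 * a)) * D1) + V) / decay_rate a b k.
Proof.
intros Ha Hs HT CX CU CX1 CX2 DX DX1 DX2 HD0 HD1 HV.
set (W := RInt (weight a b) 0 1).
(* [e * K] collects all the errors: from phi at the initial time, from phi at the
   boundary data, and from the defect of homogeneity. *)
set (K := exp (- decay_rate a b k * T) * W
  + (a * PI * (1 + exp (b / (2 * a))) + Rabs k * W) / decay_rate a b k).
apply le_epsilon; intros eps Heps.
assert (HK := Rabs_pos K).
set (e := eps / (Rabs K + 1)).
assert (He : 0 < e) by (apply Rdiv_lt_0_compat; lra).
assert (HeK : e * K <= eps).
{ apply Rle_trans with (e * (Rabs K + 1)).
  - apply Rmult_le_compat_l; [lra |]. assert (H := Rle_abs K); lra.
  - unfold e; right; field; lra. }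
assert (CXs : forall s z, continuous (X s) z).
{ intros s z; now apply continuity_2d_continuous_r. }
assert (Cw := fun z => continuous_weight a b z Ha).
assert (Cabs : forall s z, continuous (fun z => weight a b z * Rabs (X s z)) z).
{ intros s z; apply (continuous_mult (K := R_AbsRing)); [apply Cw |].
  apply (continuous_comp (X s) Rabs); [apply CXs | apply continuous_Rabs]. }
assert (Csm : forall s z, continuous (fun z => weight a b z * smooth_abs e (X s z)) z).
{ intros s z; apply (continuous_mult (K := R_AbsRing)); [apply Cw |].
  apply (continuous_comp (X s)); [apply CXs | now apply continuous_smooth_abs]. }
assert (HL : norm_1w a b (X T) <=
  RInt (fun z => weight a b z * smooth_abs e (X T z)) 0 1).
{ apply RInt_le; [lra | | |].
  - apply (continuous_ex_RInt_unit _ (Cabs T)).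
  - apply (continuous_ex_RInt_unit _ (Csm T)).
  - intros z Hz; apply Rmult_le_compat_l; [apply weight_ge_0; lra |].
    now apply smooth_abs_bounds. }
assert (HR : RInt (fun z => weight a b z * smooth_abs e (X 0 z)) 0 1 <=
  norm_1w a b (X 0) + e * W).
{ assert (I := is_RInt_plus (V := R_NormedModule) _ _ _ _ _ _
    (continuous_is_RInt_unit _ (Cabs 0))
    (is_RInt_scal (V := R_NormedModule) _ _ _ e _ (continuous_is_RInt_unit _ Cw))).
  refine (is_RInt_le _ _ 0 1 _ _ Rle_0_1
    (continuous_is_RInt_unit _ (Csm 0)) I _).
  intros z Hz.
  change (weight a b z * smooth_abs e (X 0 z) <=
    weight a b z * Rabs (X 0 z) + e * weight a b z).
  assert (H1 := proj2 (proj2 (smooth_abs_bounds e (X 0 z) He))).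
  assert (H2 : 0 <= weight a b z) by (apply weight_ge_0; lra).
  apply (Rmult_le_compat_l _ _ _ H2) in H1; lra. }
assert (HE := smooth_energy_estimate a b k e T D0 D1 V X X1 X2 U
  Ha Hs He HT CX CU CX1 CX2 DX DX1 DX2 HD0 HD1 HV).
apply (Rmult_le_compat_l (exp (- decay_rate a b k * T))) in HR;
  [| apply Rlt_le, exp_pos].
fold W in HE.
replace (_ / decay_rate a b k) with
  ((a * PI * (D0 + exp (b / (2 * a)) * D1) + V) / decay_rate a b k +
   e * ((a * PI * (1 + exp (b / (2 * a))) + Rabs k * W) / decay_rate a b k)) in HE
  by (field; lra).
unfold K in HeK; lra.
Qed.

(** * Solutions on the closed half-strip *)

(** The retraction of the line onto [0,1]. *)
Definition to_unit (z : R) : R := Rmax 0 (Rmin 1 z).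

Lemma to_unit_in (z : R) : unit_interval (to_unit z).
Proof.
unfold unit_interval, to_unit, Rmax, Rmin; repeat destruct Rle_dec; lra.
Qed.

Lemma to_unit_id (z : R) : 0 <= z <= 1 -> to_unit z = z.
Proof.
unfold to_unit, Rmax, Rmin; repeat destruct Rle_dec; lra.
Qed.

Lemma continuous_to_unit (z : R) : continuous to_unit z.
Proof.
apply Lipschitz1_continuous; intros y; unfold to_unit, Rmax, Rmin, Rabs.
repeat destruct Rle_dec; repeat destruct Rcase_abs; lra.
Qed.

Lemma continuous_Rmax0 (s : R) : continuous (Rmax 0) s.
Proof.
apply Lipschitz1_continuous; intros y; unfold Rmax, Rabs.
repeat destruct Rle_dec; repeat destruct Rcase_abs; lra.
Qed.

Lemma locally_pos (s : R) : 0 < s -> locally s (fun r => 0 < r).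
Proof. intros Hs; apply (open_gt 0 s Hs). Qed.

Lemma locally_unit (z : R) : 0 < z < 1 -> locally z (fun u => 0 < u < 1).
Proof.
intros [H0 H1]; apply filter_and; [now apply (open_gt 0 z) | now apply (open_lt 1 z)].
Qed.

(** On the open interval the one-sided notions become ordinary derivatives, so
    that [fz t] coincides there with the first derivative of the C^2 profile
    [x t], and the equation can be solved for the second one. *)
Lemma solution_spatial_derivatives (a b k : R) (x0 : R -> R) (v : R -> R -> R)
    (d0 d1 : R -> R) (x ft fz : R -> R -> R) :
  0 < a -> is_solution a b k x0 v d0 d1 x ->
  (forall t z, pos_reals t -> unit_interval z ->
       is_derive_within pos_reals (fun s => x s z) t (ft t z) /\
       is_derive_within unit_interval (fun y => x t y) z (fz t z)) ->
  forall t z, 0 < t -> 0 < z < 1 ->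
    is_derive (x t) z (fz t z) /\
    is_derive (fz t) z ((ft t z - b * fz t z - k * x t z - v t z) / a).
Proof.
intros Ha [_ [_ [HC2 [Hpde _]]]] Hd t z Ht Hz.
assert (Hin : forall u, 0 < u < 1 -> locally u unit_interval).
{ intros u Hu; generalize (locally_unit u Hu); apply filter_imp.
  unfold unit_interval; intros; lra. }
assert (Dz : forall u, 0 < u < 1 -> is_derive (x t) u (fz t u)).
{ intros u Hu; apply (is_derive_of_within unit_interval); [now apply Hin |].
  apply Hd; [exact Ht | unfold unit_interval; lra]. }
split; [now apply Dz |].
destruct (HC2 t (Rlt_le _ _ Ht)) as [f1 [D1 [f2 [D2 _]]]].
assert (E1 : forall u, 0 < u < 1 -> f1 u = fz t u).
{ intros u Hu.
  rewrite <- (is_derive_unique _ _ _ (Dz u Hu)); symmetry; apply is_derive_unique.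
  apply (is_derive_of_within unit_interval); [now apply Hin |].
  apply D1; unfold unit_interval; lra. }
assert (Dzz : is_derive (fz t) z (f2 z)).
{ apply (is_derive_ext_loc f1).
  - generalize (locally_unit z Hz); apply filter_imp; exact E1.
  - apply (is_derive_of_within unit_interval); [now apply Hin |].
    apply D2; unfold unit_interval; lra. }
assert (E2 : Derive_n (x t) 2 z = f2 z).
{ apply is_derive_unique, (is_derive_ext_loc (fz t)); [| exact Dzz].
  generalize (locally_unit z Hz); apply filter_imp; intros u Hu; symmetry.
  now apply is_derive_unique, Dz. }
assert (Et : Derive (fun s => x s z) t = ft t z).
{ apply is_derive_unique, (is_derive_of_within pos_reals); [now apply locally_pos |].
  apply Hd; [exact Ht | unfold unit_interval; lra]. }
assert (E := Hpde t z Ht Hz).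
rewrite Et, E2, (is_derive_unique _ _ _ (Dz z Hz)) in E.
replace (_ / a) with (f2 z); [exact Dzz |].
rewrite E; field; lra.
Qed.

Theorem theorem2p4 (a b k : R) (Ha : 0 < a)
    (Hk : k < a * PI ^ 2 + b ^ 2 / (4 * a))
    (x0 : R -> R) (Hx0 : Cn_on 2 unit_interval x0)
    (v : R -> R -> R) (Hv : C1_on2 nonneg_reals unit_interval v)
    (d0 d1 : R -> R) (Hd : Phi a b k x0 v d0 d1)
    (x : R -> R -> R) (Hx : is_solution a b k x0 v d0 d1 x)
    (t : R) (Ht : 0 <= t) :
  norm_1w a b (x t) <=
    exp (- (a * PI ^ 2 - k + b ^ 2 / (4 * a)) * t) * norm_1w a b (x 0)
    + 4 * a ^ 2 * PI / (4 * a ^ 2 * PI ^ 2 + b ^ 2 - 4 * a * k)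
      * (max_over (fun s => 0 <= s <= t) (fun s => Rabs (d0 s))
         + exp (b / (2 * a))
           * max_over (fun s => 0 <= s <= t) (fun s => Rabs (d1 s)))
    + 4 * a / (4 * a ^ 2 * PI ^ 2 + b ^ 2 - 4 * a * k)
      * max_over (fun s => 0 <= s <= t) (fun s =>
          max_over (fun z => 0 <= z <= 1) (fun z =>
            Rabs (v s z) * exp (b * z / (2 * a)) * sin (PI * z))).
Proof.
assert (Hsol := Hx).
destruct Hsol as [Cx [[_ [ft [fz [Hder [Cft Cfz]]]]] [_ [_ [Hbd _]]]]].
assert (Hsp := solution_spatial_derivatives a b k x0 v d0 d1 x ft fz Ha Hx Hder).
destruct Hv as [Cv _].
(* Composition with the retraction onto the closed half-strip extends all the
   functions to the plane.  [X2] is the second space derivative as given by the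
   equation; this expression is meaningful, and continuous, at z = 0 and z = 1. *)
set (X := fun s z => x (Rmax 0 s) (to_unit z)).
set (U := fun s z => v (Rmax 0 s) (to_unit z)).
set (X1 := fun s z => fz (Rmax 0 s) (to_unit z)).
set (X2 := fun s z =>
  (ft (Rmax 0 s) (to_unit z) - b * X1 s z - k * X s z - U s z) * / a).
assert (Cnn : forall f, C0_on2 nonneg_reals unit_interval f -> forall s z,
  continuity_2d_pt (fun s z => f (Rmax 0 s) (to_unit z)) s z).
{ intros f Hf s z; apply (C0_on2_comp _ _ _ _ _ _ _ Hf).
  - apply filter_forall; intros r; apply Rmax_l.
  - exact to_unit_in.
  - apply continuous_Rmax0.
  - apply continuous_to_unit. }
assert (Cpos : forall f, C0_on2 pos_reals unit_interval f -> forall s z, 0 < s ->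
  continuity_2d_pt (fun s z => f (Rmax 0 s) (to_unit z)) s z).
{ intros f Hf s z Hs; apply (C0_on2_comp _ _ _ _ _ _ _ Hf).
  - generalize (locally_pos s Hs); apply filter_imp; intros r Hr.
    exact (Rlt_le_trans _ _ _ Hr (Rmax_r 0 r)).
  - exact to_unit_in.
  - apply continuous_Rmax0.
  - apply continuous_to_unit. }
assert (CX := Cnn x Cx : forall s z, continuity_2d_pt X s z).
assert (CU := Cnn v Cv : forall s z, continuity_2d_pt U s z).
assert (CX1 := Cpos fz Cfz : forall s z, 0 < s -> continuity_2d_pt X1 s z).
assert (CX2 : forall s z, 0 < s -> continuity_2d_pt X2 s z).
{ intros s z Hs; unfold X2.
  repeat first [apply CX | apply CU | now apply CX1 | now apply (Cpos ft)
    | apply continuity_2d_pt_const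
    | apply (continuity_2d_pt_minus (fun s z => _) (fun s z => _))
    | apply (continuity_2d_pt_mult (fun s z => _) (fun s z => _)) ]. }
assert (EX : forall f : R -> R -> R, forall s z, 0 <= s -> 0 <= z <= 1 ->
  f (Rmax 0 s) (to_unit z) = f s z).
{ intros f s z Hs Hz; now rewrite Rmax_right, to_unit_id. }
assert (DX : forall s z, 0 < s ->
  is_derive (fun r => X r z) s (a * X2 s z + b * X1 s z + k * X s z + U s z)).
{ intros s z Hs.
  replace (_ + _) with (ft s (to_unit z)).
  - apply (is_derive_ext_loc (fun r => x r (to_unit z))).
    + generalize (locally_pos s Hs); apply filter_imp; intros r Hr.
      unfold X; rewrite Rmax_right by lra; easy.
    + apply (is_derive_of_within pos_reals); [now apply locally_pos |].
      apply Hder; [exact Hs | apply to_unit_in].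
  - unfold X2; rewrite (Rmax_right 0 s) by lra; field; lra. }
assert (Eloc : forall f : R -> R -> R, forall s z, 0 < s -> 0 < z < 1 ->
  locally z (fun u => f s u = f (Rmax 0 s) (to_unit u))).
{ intros f s z Hs Hz; generalize (locally_unit z Hz); apply filter_imp; intros u Hu.
  symmetry; apply EX; lra. }
assert (DX1 : forall s z, 0 < s -> 0 < z < 1 -> is_derive (X s) z (X1 s z)).
{ intros s z Hs Hz; apply (is_derive_ext_loc _ _ _ _ (Eloc x s z Hs Hz)).
  unfold X1; rewrite EX by lra; now apply Hsp. }
assert (DX2 : forall s z, 0 < s -> 0 < z < 1 -> is_derive (X1 s) z (X2 s z)).
{ intros s z Hs Hz; apply (is_derive_ext_loc _ _ _ _ (Eloc fz s z Hs Hz)).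
  unfold X2, X1, X, U; rewrite !EX by lra; now apply Hsp. }
assert (Hrate : 0 < decay_rate a b k) by (unfold decay_rate; lra).
set (D0 := max_over _ (fun s => Rabs (d0 s))).
set (D1 := max_over _ (fun s => Rabs (d1 s))).
set (V := max_over _ (fun s => max_over _ _)).
assert (CabsX : forall s z, continuity_2d_pt (fun s z => Rabs (X s z)) s z).
{ intros s z; apply continuity_1d_2d_pt_comp;
    [apply continuity_pt_filterlim, continuous_Rabs | apply CX]. }
(* These bounds make the suprema in the statement finite. *)
destruct (continuity_2d_bounded _ t 1 CabsX) as [MX HMX].
destruct (continuity_2d_bounded (fun s z => weight a b z * Rabs (U s z)) t 1) as [MV HMV].
{ intros s z; apply continuity_2d_pt_mult.
  - now apply continuity_2d_snd, continuous_weight.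
  - apply continuity_1d_2d_pt_comp;
    [apply continuity_pt_filterlim, continuous_Rabs | apply CU]. }
assert (HV : forall s z, 0 <= s <= t -> 0 <= z <= 1 ->
  Rabs (v s z) * exp (b * z / (2 * a)) * sin (PI * z) = weight a b z * Rabs (U s z)).
{ intros s z Hs Hz; unfold U, weight; rewrite EX by lra; ring. }
assert (HE := energy_estimate a b k t D0 D1 V X X1 X2 U Ha Hrate Ht
  CX CU CX1 CX2 DX DX1 DX2).
assert (Hn : forall s, 0 <= s -> norm_1w a b (X s) = norm_1w a b (x s)).
{ intros s Hs; apply RInt_ext; intros z.
  rewrite Rmin_left, Rmax_right by lra; intros Hz; unfold X; rewrite EX by lra; easy. }
rewrite !Hn in HE by lra.
(* Both denominators are 4 a c, hence the gains are a pi / c and 1 / c. *)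
fold (decay_rate a b k).
replace (4 * a ^ 2 * PI ^ 2 + b ^ 2 - 4 * a * k) with (4 * a * decay_rate a b k)
  by (unfold decay_rate; field; lra).
replace (_ + _ * V) with (exp (- decay_rate a b k * t) * norm_1w a b (x 0) +
  (a * PI * (D0 + exp (b / (2 * a)) * D1) + V) / decay_rate a b k) by (field; lra).
assert (Hdata : forall i d, 0 <= i <= 1 -> (forall s, 0 <= s -> x s i = d s) ->
  forall s, 0 <= s <= t ->
  Rabs (X s i) <= max_over (fun s => 0 <= s <= t) (fun s => Rabs (d s))).
{ intros i d Hi Hxd s Hs; unfold X; rewrite EX, Hxd by lra.
  apply (max_over_between _ (fun s => Rabs (d s)) MX); [exact Hs |].
  intros r Hr; rewrite <- Hxd by lra.
  rewrite <- (EX x) by lra; now apply HMX. }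
apply HE.
- apply Hdata; [lra | intros s Hs; now apply Hbd].
- apply Hdata; [lra | intros s Hs; now apply Hbd].
- intros s z Hs Hz; rewrite <- HV by easy.
  apply Rle_trans with (max_over (fun z => 0 <= z <= 1)
    (fun z => Rabs (v s z) * exp (b * z / (2 * a)) * sin (PI * z))).
  + apply (max_over_between _ (fun z => Rabs (v s z) * exp (b * z / (2 * a)) * sin (PI * z)) MV);
      [exact Hz |].
    intros u Hu; rewrite HV by easy; now apply HMV.
  + apply (max_over_between _ (fun s => max_over (fun z => 0 <= z <= 1)
      (fun z => Rabs (v s z) * exp (b * z / (2 * a)) * sin (PI * z))) MV); [exact Hs |].
    intros r Hr; apply (max_over_between _ _ MV 0); [lra |].
    intros u Hu; rewrite HV by easy; now apply HMV.
Qed.
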